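(* Let $N\geq 2$ and $n\geq 3$ be integers and consider the ideal $I_{N,n}\subset\mathbb{C}[x_0,\ldots,x_N]$. a) Let $N=2M$ be even. For a subset $A=\{i_1,\ldots,i_M\}$ of $M$ elements of $\{0,1,\ldots,N\}$ with complementary set $B=\{j_0,\ldots,j_M\}$, put $$g_A=x_{i_1}\cdots x_{i_M}\,[x_{i_1}\ldots x_{i_M}]\,[x_{j_0}\ldots x_{j_M}].$$ Then $I_{N,n}$ is generated by all the polynomials $g_A$, where $A$ runs over all $M$-element subsets of $\{0,1,\ldots,N\}$. b) Let $N=2M+1$ be odd. For a subset $A=\{i_0,\ldots,i_M\}$ of $M+1$ elements of $\{0,1,\ldots,N\}$ with complementary set $B=\{j_0,\ldots,j_M\}$, put $$g_A=x_{i_0}\cdots x_{i_M}\,[x_{i_0}\ldots x_{i_M}]\,[x_{j_0}\ldots x_{j_M}].$$ Then $I_{N,n}$ is generated by all the polynomials $g_A$, where $A$ runs over all $(M+1)$-element subsets of $\{0,1,\ldots,N\}$.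
   Context: Let $\mathbb{C}[x_0,\ldots,x_N]$ be the homogeneous coordinate ring of the complex projective space $\mathbb{P}^N$. The Fermat-type arrangement of hyperplanes of degree $n$ in $\mathbb{P}^N$ consists of the hyperplanes defined by the linear factors of $$F_{N,n}=\prod_{0\leq i<j\leq N}(x_i^n-x_j^n).$$ Let $V_{N,n}\subset\mathbb{P}^N$ be the union of all codimension $2$ linear subspaces (flats) $W$ of $\mathbb{P}^N$ such that at least $3$ distinct hyperplanes of this arrangement contain $W$. Let $I_{N,n}$ be the radical homogeneous ideal defining $V_{N,n}$, i.e. the ideal of all polynomials vanishing along $V_{N,n}$. Bracket notation (with $n$ fixed): for a finite sequence of variables $z_1,\ldots,z_r$, $$[z_1\ldots z_r]=\prod_{1\leq p<q\leq r}(z_p^n-z_q^n),$$ with the convention that the bracket of a single variable is the empty product $1$. Changing the order in which the elements of $A$ or of $B$ are listed changes $g_A$ at most by a sign. *)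

(* Defs.v *)
From HB Require Import structures.
From mathcomp Require Import all_boot all_order all_algebra.
From mathcomp Require Import reals.
From mathcomp Require Import complex.
From mathcomp Require Import mpoly.

Set Implicit Arguments.
Unset Strict Implicit.
Unset Printing Implicit Defensive.

Import GRing.Theory.
Local Open Scope ring_scope.

(* [z_1 ... z_r] in the text; the exponent n is explicit here. *)
Definition bracket (S : comNzRingType) (n : nat) (z : seq S) : S :=
  \prod_(q < size z) \prod_(p < size z | (p < q)%N) (z`_p ^+ n - z`_q ^+ n).

Section FermatArrangement.

Variable C : fieldType.
Variables N n : nat.

Definition fermat_poly : {mpoly C[N.+1]} :=
  \prod_(j < N.+1) \prod_(i < N.+1 | (i < j)%N) ('X_i ^+ n - 'X_j ^+ n).

Definition eval_at (f : {mpoly C[N.+1]}) (v : 'rV[C]_N.+1) : C :=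
  f.@[fun i => v ord0 i].

Definition linear_factor (l F : {mpoly C[N.+1]}) : Prop :=
  [/\ l != 0, l \is 1.-homog & exists q : {mpoly C[N.+1]}, F = q * l].

(* A linear subspace of P^N is represented by its affine cone in C^(N+1), so
   codimensions agree and the projective dimension is one less than \dim. *)
Definition fermat_hyperplane (H : {vspace 'rV[C]_N.+1}) : Prop :=
  exists2 l : {mpoly C[N.+1]}, linear_factor l fermat_poly &
    forall v : 'rV[C]_N.+1, v \in H <-> eval_at l v = 0.

Definition fermat_flat (W : {vspace 'rV[C]_N.+1}) : Prop :=
  (\dim W + 2 = N.+1)%N /\
  exists H1 H2 H3 : {vspace 'rV[C]_N.+1},
    [/\ uniq [:: H1; H2; H3],
        fermat_hyperplane H1 /\ (W <= H1)%VS,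
        fermat_hyperplane H2 /\ (W <= H2)%VS &
        fermat_hyperplane H3 /\ (W <= H3)%VS].

(* v is a vector of homogeneous coordinates of a point of V_{N,n}. *)
Definition fermat_locus (v : 'rV[C]_N.+1) : Prop :=
  v != 0 /\ exists2 W : {vspace 'rV[C]_N.+1}, fermat_flat W & v \in W.

(* An arbitrary (not necessarily homogeneous) polynomial vanishes at a point of
   P^N when it vanishes at all vectors of homogeneous coordinates of it. *)
Definition fermat_ideal (f : {mpoly C[N.+1]}) : Prop :=
  forall v : 'rV[C]_N.+1, fermat_locus v -> eval_at f v = 0.

(* The elements of A and of its complement are listed in increasing order. *)
Definition fermat_gen (A : {set 'I_N.+1}) : {mpoly C[N.+1]} :=
  (\prod_(i in A) 'X_i)
  * bracket n [seq 'X_i | i <- enum A]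
  * bracket n [seq 'X_j | j <- enum (~: A)].

End FermatArrangement.

Definition generated_by (S : comNzRingType) (T : finType) (P : pred T)
    (g : T -> S) (I : S -> Prop) : Prop :=
  forall f : S, I f <-> exists c : T -> S, f = \sum_(t | P t) c t * g t.

(* Main.v *)
Require Import Defs.
From HB Require Import structures.
From mathcomp Require Import all_boot all_order all_algebra.
From mathcomp Require Import separable cyclic cyclotomic.
From mathcomp Require Import reals.
From mathcomp Require Import complex.
From mathcomp Require Import mpoly.
From mathcomp Require Import ring zify.

(* Put y_i = x_i^n.  A codimension 2 flat lying on three hyperplanes
   x_i = z x_j is given by x_i = x_j = 0 or by x_i = z x_j = w x_k.  Averaging
   over n-th roots of unity, every f in the ideal is a sum of x^e f_e(y) with
   each summand in the ideal.  If T is the set of indices with e_i = 0, this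
   says that f_e vanishes on y_a = y_b = y_c for all distinct a, b, c, and on
   y_a = y_b = 0 for distinct a, b in T.

   It remains to generate such ideals J(X, T, s), with s the value (0 above)
   taken on T, by the products prod_{a in A n T} (s - y_a) [A] [X \ A] with
   |A| = |X| / 2 rounded down; this is in the spirit of Li and Li's theorem on
   polynomials vanishing where three variables coincide.  By induction on |X|,
   treat s as a variable and specialise it to y_i for i in T in turn: if f is
   already divisible by the product of s - y_l over l in L, the specialised
   quotient is a multiple, by the product of y_i - y_j over the other j in
   T \ L, of an element of an ideal J(X \ i, T', y_i), and the generators of
   the latter lift to generators of J(X, T, s).  Once all of T is used up,
   there remains J(X, {}, s) = J(X \ t, X \ t, y_t) for any t in X. *)

Set Implicit Arguments.
Unset Strict Implicit.
Unset Printing Implicit Defensive.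

Import GRing.Theory Num.Theory.
Local Open Scope ring_scope.

(** Ideals are predicates, so that preimages under arbitrary operations can serve as ideals in the
    induction below. *)
Definition ideal (S : comNzRingType) (I : S -> Prop) : Prop :=
  [/\ I 0, forall p q, I p -> I q -> I (p + q) & forall r p, I p -> I (r * p)].

Lemma ideal_sub (S : comNzRingType) (I : S -> Prop) p q :
  ideal I -> I p -> I q -> I (p - q).
Proof. by case=> _ ID IM Ip Iq; apply: ID => //; rewrite -mulN1r; apply: IM. Qed.

(** * Vandermonde products and the candidate generators *)

Section Vandermonde.
Variables (k : nat) (S : comNzRingType).
Implicit Types (y : 'I_k -> S) (A B T X : {set 'I_k}).

Definition vdm y A : S := \prod_(q in A) \prod_(p in A | (p < q)%N) (y p - y q).

Lemma vdm0 y : vdm y set0 = 1.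
Proof. by rewrite /vdm big_set0. Qed.

Lemma vdm_eq0 y A a b : a \in A -> b \in A -> a != b -> y a = y b -> vdm y A = 0.
Proof.
wlog lt_ab : a b / (a < b)%N => [WL | ] Aa Ab neq_ab yab.
  case: (ltngtP a b) => [lt_ab | lt_ba | /val_inj eq_ab]; first exact: (WL a b).
  - by apply: (WL b a) => //; rewrite eq_sym.
  - by rewrite eq_ab eqxx in neq_ab.
rewrite /vdm (bigD1 b) //= (bigD1 a) /=; last by rewrite Aa lt_ab.
by rewrite yab subrr !mul0r.
Qed.

Lemma vdm_setU1 y i A : i \notin A ->
  exists b : bool,
    vdm y (i |: A) = (-1) ^+ b * (\prod_(a in A) (y i - y a)) * vdm y A.
Proof.
move=> iA.
have neq_i a : a \in A -> (a == i) = false by apply: contraTF => /eqP->.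
have inner q : q \in A -> \prod_(p in i |: A | (p < q)%N) (y p - y q)
    = (if (i < q)%N then y i - y q else 1) *
      \prod_(p in A | (p < q)%N) (y p - y q).
  move=> Aq; rewrite [in LHS]big_mkcondr [in RHS]big_mkcondr /=.
  by rewrite big_setU1.
rewrite /vdm big_setU1 //= (eq_bigr _ inner) big_split /= mulrA.
have -> : \prod_(p in i |: A | (p < i)%N) (y p - y i)
    = \prod_(p in A) (if (p < i)%N then y p - y i else 1).
  by rewrite big_mkcondr big_setU1 //= ltnn mul1r.
rewrite -big_split /=.
(* Each [a < i] contributes its factor with the opposite orientation, so the sign is the parity of
   the number of such [a]. *)
pose m := (\sum_(a in A) (a < i))%N.
exists (odd m); rewrite signr_odd; congr (_ * _).
rewrite /m -prodrXr -big_split /=; apply: eq_bigr => a Aa.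
case: (ltngtP a i) => [_|_|/val_inj eq_ai]; rewrite /= ?expr1 ?expr0; try ring.
by rewrite -eq_ai Aa in iA.
Qed.

(* [z] plays the role of an extra variable that has to differ only from the
   variables in [T]. *)
Definition gen y z X T A : S :=
  (\prod_(a in A :&: T) (z - y a)) * vdm y A * vdm y (X :\: A).

(** Pigeonhole: two of the three indices lie on the same side, [A] or [X :\: A], and the bracket of
    that side vanishes. *)
Lemma gen_eq0_triple y z X T A a b c :
  [set a; b; c] \subset X -> uniq [:: a; b; c] -> y a = y b -> y b = y c ->
  gen y z X T A = 0.
Proof.
move=> /subsetP sX /= /and3P[]; rewrite !inE negb_or => /andP[nab nac] nbc _ yab ybc.
have [Xa Xb Xc] : [/\ a \in X, b \in X & c \in X].
  by split; apply: sX; rewrite !inE eqxx ?orbT.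
have pair u v : u != v -> y u = y v -> u \in X -> v \in X ->
    (u \in A) = (v \in A) -> gen y z X T A = 0.
  move=> nuv yuv Xu Xv eqA; rewrite /gen; case Au: (u \in A).
    by rewrite (@vdm_eq0 _ A u v) ?mulr0 ?mul0r // -eqA.
  by rewrite (@vdm_eq0 _ (X :\: A) u v) ?mulr0 // !inE -?eqA Au.
case Aa: (a \in A); case Ab: (b \in A); case Ac: (c \in A);
  first [ by apply: (pair a b) => //; rewrite Aa Ab
        | by apply: (pair b c) => //; rewrite Ab Ac
        | by apply: (pair a c) => //; rewrite ?Aa ?Ac // yab ].
Qed.

(** An index in [A] kills its linear factor; if neither is in [A], both lie in [X :\: A] and kill
    its bracket. *)
Lemma gen_eq0_pair y z X T A a b :
  T \subset X -> a \in T -> b \in T -> a != b -> y a = y b -> y b = z ->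
  gen y z X T A = 0.
Proof.
move=> /subsetP sTX Ta Tb nab yab ybz.
have inA u : u \in T -> y u = z -> u \in A -> gen y z X T A = 0.
  move=> Tu yu Au; rewrite /gen (bigD1 u) /= ?inE ?Au //.
  by rewrite yu subrr !mul0r.
case Aa: (a \in A); first by apply: (inA a) => //; rewrite yab.
case Ab: (b \in A); first exact: (inA b).
by rewrite /gen (@vdm_eq0 _ (X :\: A) a b) ?mulr0 // !inE ?Aa ?Ab /= sTX.
Qed.

End Vandermonde.

Lemma rmorph_vdm k (S S' : comNzRingType) (f : {rmorphism S -> S'})
    (y : 'I_k -> S) A : f (vdm y A) = vdm (f \o y) A.
Proof.
rewrite rmorph_prod; apply: eq_bigr => q _; rewrite rmorph_prod.
by apply: eq_bigr => p _; rewrite rmorphB.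
Qed.

Lemma rmorph_gen k (S S' : comNzRingType) (f : {rmorphism S -> S'})
    (y : 'I_k -> S) z X T A : f (gen y z X T A) = gen (f \o y) (f z) X T A.
Proof.
rewrite !rmorphM !rmorph_vdm rmorph_prod; congr (_ * _ * _).
by apply: eq_bigr => a _; rewrite rmorphB.
Qed.

Lemma eq_vdm k (S : comNzRingType) (y y' : 'I_k -> S) A : y =1 y' -> vdm y A = vdm y' A.
Proof. by move=> yy'; apply: eq_bigr => q _; apply: eq_bigr => p _; rewrite !yy'. Qed.

(** * Renamings of variables and vanishing where variables coincide *)

Section Renaming.
Variables (k : nat) (R : idomainType).
Local Notation P := {mpoly R[k]}.
Implicit Types (p q f u : P) (s t : 'I_k -> 'I_k).

Definition ren s : P -> P := comp_mpoly [tuple 'X_(s i) | i < k].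

HB.instance Definition _ s := GRing.RMorphism.copy (ren s) (ren s).

Lemma renX s i : ren s 'X_i = 'X_(s i).
Proof. by rewrite /ren comp_mpolyXU -tnth_nth tnth_mktuple. Qed.

Lemma renC s c : ren s c%:MP = c%:MP.
Proof. exact: comp_mpolyC. Qed.

Lemma mpoly_ring_ind (Q : P -> Prop) :
  (forall c, Q c%:MP) -> (forall i, Q 'X_i) ->
  (forall p q, Q p -> Q q -> Q (p + q)) ->
  (forall p q, Q p -> Q q -> Q (p * q)) -> forall p, Q p.
Proof.
move=> QC QX QD QM; elim/mpolyind => [|c m p _ _ Qp]; first by rewrite -mpolyC0.
apply: QD => //; rewrite -mul_mpolyC; apply: (QM) => //.
rewrite mpolyXE_id; elim/big_rec: _ => [|i q _ Qq]; first by rewrite -mpolyC1.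
apply: (QM) => //; elim: (m i) => [|e IH]; first by rewrite expr0 -mpolyC1.
by rewrite exprS; apply: (QM).
Qed.

Lemma ren_comp s t p : ren s (ren t p) = ren (s \o t) p.
Proof.
elim/mpoly_ring_ind: p => [c|i|p q IHp IHq|p q IHp IHq].
- by rewrite !renC.
- by rewrite !renX.
- by rewrite !rmorphD /= IHp IHq.
- by rewrite !rmorphM /= IHp IHq.
Qed.

Lemma eq_ren s t p : s =1 t -> ren s p = ren t p.
Proof. by move=> st; congr (comp_mpoly _ p); apply: eq_mktuple => i; rewrite st. Qed.

Lemma subX_neq0 i j : i != j -> 'X_i - 'X_j != 0 :> P.
Proof.
rewrite subr_eq0; apply: contraNneq => /mpolyP/(_ U_(i)%MM).
rewrite !mcoeffX eqxx; case: eqP => [/mnmP/(_ i)|_ /eqP]; last by rewrite oner_eq0.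
by rewrite !mnm1E eqxx; case: eqP => // ->.
Qed.

Definition identify (a b i : 'I_k) : 'I_k := if i == b then a else i.

Lemma identify_comp a b s : s a = s b -> s \o identify a b =1 s.
Proof. by move=> sab i /=; rewrite /identify; case: eqP => // ->. Qed.

(** Congruence modulo ['X_b - 'X_a] respects sums and products, so only variables need checking.
    This gives the factor theorem for ['X_b - 'X_a]. *)
Lemma sub_ren_identify a b p : exists q, p - ren (identify a b) p = ('X_b - 'X_a) * q.
Proof.
elim/mpoly_ring_ind: p => [c|i|p q [p' Hp] [q' Hq]|p q [p' Hp] [q' Hq]].
- by exists 0; rewrite renC subrr mulr0.
- rewrite renX /identify; case: eqP => [->|_]; first by exists 1; rewrite mulr1.
  by exists 0; rewrite subrr mulr0.
- by exists (p' + q'); rewrite rmorphD mulrDr -Hp -Hq /=; ring.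
- exists (p' * q + ren (identify a b) p * q'); rewrite rmorphM mulrDr /=.
  by rewrite mulrA -Hp mulrCA -Hq; ring.
Qed.

Lemma ren_identify_eq0 a b p : ren (identify a b) p = 0 -> exists q, p = ('X_b - 'X_a) * q.
Proof. by move=> p0; have [q] := sub_ren_identify a b p; rewrite p0 subr0; exists q. Qed.

(** The factors are divided out one by one: setting ['X_j] to ['X_i] keeps the product of the other
    factors nonzero, so over a domain it kills the cofactor. *)
Lemma dvd_prod_subX i (H : {set 'I_k}) p : i \notin H ->
  (forall j, j \in H -> ren (identify i j) p = 0) ->
  exists q, p = (\prod_(j in H) ('X_i - 'X_j)) * q.
Proof.
have [m] := ubnP #|H|; elim: m => // m IH in H p *; rewrite ltnS => cH iH pH.
have [-> | [j jH]] := set_0Vmem H; first by exists p; rewrite big_set0 mul1r.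
have nij : i != j by apply: contraNneq iH => ->.
have [|||q pq] := IH (H :\ j) p.
- by move: cH; rewrite (cardsD1 j) jH.
- by rewrite !inE negb_and iH orbT.
- by move=> l; rewrite !inE => /andP[_]; apply: pH.
have: ren (identify i j) q = 0.
  have := pH j jH; rewrite pq rmorphM => /eqP; rewrite mulf_eq0.
  case/orP => [|/eqP//]; rewrite rmorph_prod prodf_seq_eq0 => /hasP[l _].
  rewrite !inE => /andP[/andP[/negPf nlj lH]].
  rewrite rmorphB /= !renX /identify (negPf nij) nlj.
  by apply: contraTeq => _; rewrite subX_neq0 //; apply: contraNneq iH => ->.
case/ren_identify_eq0 => q' qq'; exists (- q').
by rewrite (big_setD1 j) //= pq qq'; ring.
Qed.

(* Vanishing on the subspace where the variables a, b, c coincide, tested on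
   renamings of the variables rather than on points. *)
Definition vanish3 (a b c : 'I_k) p : Prop :=
  forall s, s a = s b -> s b = s c -> ren s p = 0.

(** No factor vanishes identically on the subspace, and the ring is a domain. It is enough to test
    on the generic renaming [s0], through which every admissible [s] factors. *)
Lemma vanish3_cancel a b c (J : {set 'I_k * 'I_k}) p :
  (forall ij, ij \in J -> ij.1 != ij.2 /\
     ((ij.1 \notin [set a; b; c]) || (ij.2 \notin [set a; b; c]))) ->
  vanish3 a b c ((\prod_(ij in J) ('X_ij.1 - 'X_ij.2)) * p) -> vanish3 a b c p.
Proof.
move=> HJ Vp s sab sbc.
pose s0 i := if i \in [set a; b; c] then a else i.
have s0S i : i \in [set a; b; c] -> s0 i = a by rewrite /s0 => ->.
have := Vp s0; rewrite !s0S ?inE ?eqxx ?orbT // => /(_ erefl erefl)/eqP.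
rewrite rmorphM mulf_eq0 => /orP[|/eqP p0]; last first.
  suff -> : ren s p = ren s (ren s0 p) by rewrite p0 rmorph0.
  rewrite ren_comp; apply: eq_ren => i /=; rewrite /s0 !inE.
  by case: (eqVneq i a) => [->|_] //; case: (eqVneq i b) => [->|_] //;
     case: eqP => [->|_] //=; rewrite sab.
rewrite rmorph_prod prodf_seq_eq0 => /hasP[[i j] _ /andP[/HJ/= [nij out]]].
rewrite rmorphB /= !renX; apply: contraTeq => _; apply: subX_neq0.
have aS : a \in [set a; b; c] by rewrite !inE eqxx.
rewrite /s0; case: ifP => iS; case: ifP => jS //.
- by rewrite iS jS in out.
- by apply: contraFneq jS => <-.
- by apply: contraFneq iS => ->.
Qed.

Lemma vanish3_cancelr a b c i (H : {set 'I_k}) p :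
  i \notin H -> (forall j, j \in H -> (i \in [set a; b; c]) -> (j \notin [set a; b; c])) ->
  vanish3 a b c ((\prod_(j in H) ('X_i - 'X_j)) * p) -> vanish3 a b c p.
Proof.
move=> iH out Vp; apply: (@vanish3_cancel a b c [set (i, j) | j in H]).
  move=> _ /imsetP[j jH ->] /=; split; first by apply: contraNneq iH => ->.
  by case: (boolP (i \in _)) => //= /(out _ jH).
by rewrite big_imset //= => j j' _ _ [].
Qed.

Local Notation y := (fun i : 'I_k => 'X_i : P).

(** The ideal J(X, T, s) of the overview, [s] being the index of a variable. *)
Definition in_locus_ideal (X T : {set 'I_k}) (s : 'I_k) f : Prop :=
  (forall a b c, [set a; b; c] \subset X -> uniq [:: a; b; c] -> vanish3 a b c f) /\
  (forall a b, a \in T -> b \in T -> a != b -> vanish3 a b s f).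

Lemma ideal_vanish3 a b c : ideal (vanish3 a b c).
Proof.
split=> [s _ _|p q Vp Vq s sab sbc|r p Vp s sab sbc]; first by rewrite rmorph0.
  by rewrite rmorphD /= Vp // Vq // addr0.
by rewrite rmorphM /= Vp // mulr0.
Qed.

Lemma ideal_locus (X T : {set 'I_k}) (s : 'I_k) : ideal (in_locus_ideal X T s).
Proof.
split=> [|p q [p1 p2] [q1 q2]|r p [p1 p2]]; split=> [a b c sX uabc|a b Ta Tb nab].
- by have [V0 _ _] := ideal_vanish3 a b c.
- by have [V0 _ _] := ideal_vanish3 a b s.
- by have [_ VD _] := ideal_vanish3 a b c; apply: VD; [apply: p1|apply: q1].
- by have [_ VD _] := ideal_vanish3 a b s; apply: VD; [apply: p2|apply: q2].
- by have [_ _ VM] := ideal_vanish3 a b c; apply: VM; apply: p1.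
- by have [_ _ VM] := ideal_vanish3 a b s; apply: VM; apply: p2.
Qed.

Lemma ren_gen s (t : 'I_k) (X T A : {set 'I_k}) : ren s (gen y 'X_t X T A) = gen (y \o s) 'X_(s t) X T A.
Proof.
rewrite (rmorph_gen (ren s)) /= renX /gen; congr (_ * _ * _).
- by apply: eq_bigr => a _; rewrite /= renX.
- by apply: eq_vdm => a /=; rewrite renX.
- by apply: eq_vdm => a /=; rewrite renX.
Qed.

Lemma gen_in_locus (X T A : {set 'I_k}) (s : 'I_k) : T \subset X -> in_locus_ideal X T s (gen y 'X_s X T A).
Proof.
move=> sTX; split=> [a b c sX uabc t tab tbc|a b Ta Tb nab t tab tbs].
  by rewrite ren_gen (@gen_eq0_triple _ _ _ _ _ _ _ a b c) //= ?tab ?tbc.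
by rewrite ren_gen (@gen_eq0_pair _ _ _ _ _ _ _ a b) //= ?tab ?tbs.
Qed.

(** A triple of [X] through [m] is a pair of [X :\ m] whose variables are made equal to the special
    variable ['X_m]. *)
Lemma locus_empty (X : {set 'I_k}) f m : m \in X ->
  (forall a b c, [set a; b; c] \subset X -> uniq [:: a; b; c] -> vanish3 a b c f) ->
  in_locus_ideal (X :\ m) (X :\ m) m f.
Proof.
move=> Xm Vf; split=> [a b c sX|a b]; first by apply: Vf; apply: subset_trans sX (subsetDl _ _).
rewrite !inE => /andP[nam Xa] /andP[nbm Xb] nab; apply: Vf.
  by rewrite !subUset !sub1set Xa Xb Xm.
by rewrite /= !inE negb_or nab nam nbm.
Qed.

End Renaming.

(** * Generation of the ideals J(X, T, s) *)

Section LocusIdeal.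
Variables (k : nat) (R : idomainType).
Local Notation P := {mpoly R[k]}.
Local Notation y := (fun i : 'I_k => 'X_i : P).
(** Halves rounded down are compatible with the induction, as c minus half of c is half of c + 1. A
    generator for [X :\ t] indexed by [A] thus corresponds to one for [X] indexed by the complement
    [B]. *)
Lemma half_complement (T : finType) (X A : {set T}) t :
  t \in X -> A \subset X :\ t -> #|A| = #|X :\ t|./2 ->
  let B := X :\ t :\: A in [/\ B \subset X, #|B| = #|X|./2 & X :\: B = t |: A].
Proof.
move=> Xt sA cA; split.
- exact: subset_trans (subsetDl _ _) (subsetDl _ _).
- rewrite (cardsD1 t X) Xt add1n cardsD (setIidPr sA) cA.
  by move: #|_ :\ _| => c; clear; lia.
- apply/setP=> j; rewrite !inE; case: eqP => [->|_] /=; first by rewrite andbF Xt.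
  case Aj: (j \in A) => /=; last by rewrite andNb.
  by have := subsetP sA _ Aj; rewrite !inE => /andP[_ ->].
Qed.

(** An arbitrary ideal [I] containing the generators replaces their span: the induction hypothesis
    is applied to preimages of [I]. *)
Theorem locus_ideal_generated (X T : {set 'I_k}) (s : 'I_k) (I : P -> Prop) :
  s \notin X -> T \subset X -> ideal I ->
  (forall A : {set 'I_k}, A \subset X -> #|A| = #|X|./2 -> I (gen y 'X_s X T A)) ->
  forall f, in_locus_ideal X T s f -> I f.
Proof.
have [m] := ubnP #|X|; elim: m => // m IHm in X T s I *; rewrite ltnS => cX sX sTX II Igen f Jf.
(* Intersecting [I] with J(X, T, s) makes membership in [I] imply membership in J, which keeps the
   remainder in J when [i] joins [L]. *)
pose I' g := I g /\ in_locus_ideal X T s g.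
have II' : ideal I'.
  have [I0 ID IM] := II; have [J0 JD JM] := ideal_locus R X T s.
  split=> [|p q [Ip Jp] [Iq Jq]|r p [Ip Jp]]; first by split.
    by split; [apply: ID|apply: JD].
  by split; [apply: IM|apply: JM].
have I'gen (A : {set 'I_k}) : A \subset X -> #|A| = #|X|./2 -> I' (gen y 'X_s X T A).
  by move=> sAX cA; split; [apply: Igen|apply: gen_in_locus].
suff [] : I' f by [].
move: (I') II' I'gen (fun g (h : I' g) => proj2 h) => {I' I II Igen} I II Igen IJ.
pose pr (L : {set 'I_k}) : P := \prod_(l in L) ('X_s - 'X_l).
(* The variable s has already been specialised to the variables in L. *)
suff chain d (L : {set 'I_k}) g : (#|T :\: L| < d)%N -> L \subset T ->
    in_locus_ideal X T s (pr L * g) -> I (pr L * g).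
  have := chain #|T :\: set0|.+1 set0 f (ltnSn _) (sub0set _).
  by rewrite /pr big_set0 mul1r; apply.
elim: d => // d IHd in L g *; rewrite ltnS => cL sLT Jg.
have sL : s \notin L by apply: contra sX => /(subsetP sLT)/(subsetP sTX).
have nsX a : a \in X -> a != s by apply: contraTneq => ->.
(* The factors of [pr L] involve [s], which is outside [X], so they cancel on triples of [X]. *)
have Vg a b c : [set a; b; c] \subset X -> uniq [:: a; b; c] -> vanish3 a b c g.
  move=> sub uabc; apply: (@vanish3_cancelr _ _ _ _ _ s L) => //; last exact: Jg.1.
  by move=> j _ /(subsetP sub); rewrite (negPf sX).
have [sTL | /subsetPn[i Ti iL]] := boolP (T \subset L).
  have eqL : L = T by apply/eqP; rewrite eqEsubset sLT.
  have [I0 ID IM] := II.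
  (* For empty [X] the generator of the empty set is 1, so [I] contains everything. *)
  have [X0 | [t Xt]] := set_0Vmem X.
    have := Igen set0 (sub0set _); rewrite X0 cards0 => /(_ erefl).
    by rewrite /gen set0I big_set0 setD0 vdm0 !mulr1 => I1; rewrite -[_ * _]mulr1; apply: IM.
  (* [T] is used up, so the special variable becomes ['X_t]; the ideal is that of all [q] with
     [pr L * q] in [I]. *)
  apply: (IHm (X :\ t) (X :\ t) t (fun q => I (pr L * q))).
  - by move: cX; rewrite (cardsD1 t) Xt.
  - by rewrite !inE eqxx.
  - by [].
  - split=> [|p q Ip Iq|r p Ip]; first by rewrite mulr0.
      by rewrite mulrDr; apply: ID.
    by rewrite mulrCA; apply: IM.
  - move=> A sA cA.
    have tA : t \notin A by apply/negP => /(subsetP sA); rewrite !inE eqxx.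
    have [b vdmE] := vdm_setU1 y tA.
    have [sBX cB XB] := half_complement Xt sA cA.
    set B := X :\ t :\: A in sBX cB XB.
    have := Igen B sBX cB; rewrite /gen XB vdmE => IB.
    rewrite /gen (setIidPl sA) -/B.
    (* The part of [pr L] over [B] gives the linear factors of the generator of [B]; the bracket of
       [t |: A] absorbs the factors ['X_t - 'X_a]. *)
    have -> : pr L * (\prod_(a in A) ('X_t - 'X_a) * vdm y A * vdm y B)
       = (-1) ^+ b * \prod_(a in L :\: B) ('X_s - 'X_a)
         * (\prod_(a in B :&: T) ('X_s - 'X_a) * vdm y B *
       ((-1) ^+ b * \prod_(a in A) ('X_t - 'X_a) * vdm y A)).
      rewrite /pr (big_setID B) /= eqL setIC.
      have := signrMK b (1 : P); rewrite mulr1.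
      set e := (-1) ^+ b => ee; rewrite -[LHS]mul1r -ee; ring.
    exact: IM.
  - exact: locus_empty.
pose H := T :\: (i |: L).
have iH : i \notin H by rewrite !inE eqxx.
have Xi : i \in X by apply: subsetP Ti.
have sHT : H \subset T by apply: subsetDl.
pose prH : P := \prod_(j in H) ('X_i - 'X_j).
have nis : i != s by apply: nsX.
pose t0 := identify i s.
have t0E a : a \in X -> t0 a = a by move=> /nsX/negPf nas; rewrite /t0 /identify nas.
have t0s : t0 s = i by rewrite /t0 /identify eqxx.
pose u := ren t0 g.
have t0K (p : P) : ren t0 (ren t0 p) = ren t0 p.
  by rewrite ren_comp; apply: eq_ren; apply: identify_comp; rewrite t0s t0E.
(* For [j] in [H], [pr L * g] vanishes where [i], [j] and [s] coincide. No factor of [pr L] does, as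
   [i] and [j] are outside [L]; hence [u] vanishes once [j] is set to [i]. *)
have [j Hj|q uq] := @dvd_prod_subX _ _ i H u iH.
  have Tj : j \in T := subsetP sHT _ Hj.
  have Xj := subsetP sTX _ Tj.
  move: (Hj); rewrite !inE negb_or -andbA => /and3P[nji jL _].
  have := Jg.2 i j Ti Tj; rewrite eq_sym nji => /(_ isT (identify i j \o t0)).
  have idi : identify i j i = i by rewrite /identify if_same.
  have idj : identify i j j = i by rewrite /identify eqxx.
  rewrite /= t0s !t0E // idi idj => /(_ erefl erefl)/eqP.
  rewrite /u ren_comp rmorphM mulf_eq0 => /orP[|/eqP//].
  rewrite rmorph_prod prodf_seq_eq0 => /hasP[l _ /andP[Ll]].
  have Xl : l \in X by apply/(subsetP sTX)/(subsetP sLT).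
  have idl : identify i j l = l.
    by rewrite /identify ifN //; apply: contraNneq jL => <-.
  rewrite rmorphB /= !renX /= t0s t0E // idi idl.
  by apply: contraTeq => _; apply: subX_neq0; apply: contraNneq iL => ->.
(* No factor of [prH] vanishes on the triples tested: those in [X :\ i] omit [i], and those formed
   by [i] and a pair outside [H] omit [H]. So [q] inherits the vanishing of [u]. *)
have Jq : in_locus_ideal (X :\ i) (X :\ i :\: H) i q.
  have Vu a b c : [set a; b; c] \subset X -> uniq [:: a; b; c] -> vanish3 a b c u.
    move=> sub uabc t tab tbc; rewrite /u ren_comp.
    by apply: (Vg a b c) => //=; rewrite !t0E //; apply: (subsetP sub); rewrite !inE eqxx ?orbT.
  have out (a b c : 'I_k) : (forall j, j \in H -> i \in [set a; b; c] -> j \notin [set a; b; c]) ->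
      [set a; b; c] \subset X -> uniq [:: a; b; c] -> vanish3 a b c q.
    by move=> Hout sub uabc; apply: vanish3_cancelr iH Hout _; rewrite -uq; apply: Vu.
  split=> [a b c sub|a b].
    apply: out; last exact: subset_trans sub (subsetDl _ _).
    by move=> j _ /(subsetP sub); rewrite !inE eqxx.
  rewrite in_setD in_setD1 => /and3P[aH nai Xa].
  rewrite in_setD in_setD1 => /and3P[bH nbi Xb] nab; apply: out.
  - by move=> j Hj _; rewrite !inE !negb_or; apply/andP; split; [apply/andP; split|];
      apply: contraTneq Hj => ->.
  - by rewrite !subUset !sub1set Xa Xb Xi.
  - by rewrite /= !inE negb_or nab nai nbi.
have cXi : #|X| = #|X :\ i|.+1 by rewrite (cardsD1 i) Xi.
have [I0 ID IM] := II.
(* The ideal consists of the [q] for which [prH * q] has a lift [g'], modulo ['X_s - 'X_i], with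
   [pr L * g'] in [I]. *)
have [| | | | |g' [Ig' t0g']] := IHm (X :\ i) (X :\ i :\: H) i
  (fun q => exists g', I (pr L * g') /\ ren t0 g' = ren t0 (prH * q)) _ _ _ _ _ q Jq.
- by rewrite -ltnS -cXi ltnS.
- by rewrite !inE eqxx.
- exact: subsetDl.
- split=> [|p p' [g1 [Ig1 t1]] [g2 [Ig2 t2]]|r p [g1 [Ig1 t1]]].
  + by exists 0; rewrite !mulr0.
  + exists (g1 + g2); rewrite !mulrDr !rmorphD /= t1 t2; split=> //; exact: ID.
  + exists (r * g1); rewrite mulrCA (mulrCA prH) !(rmorphM (ren t0)) /= t1 rmorphM; split=> //.
    exact: IM.
- move=> A sA cA.
  have iA : i \notin A by apply/negP => /(subsetP sA); rewrite !inE eqxx.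
  have [b vdmE] := vdm_setU1 y iA.
  have [sBX cB XB] := half_complement Xi sA cA.
  set B := X :\ i :\: A in sBX cB XB.
  (* Modulo s = i this is the product over H times the generator given by A,
     and it becomes a multiple of the generator given by B after multiplying
     by pr L. *)
  exists ((-1) ^+ b * vdm y (i |: A) * (\prod_(j in H :&: B) ('X_s - 'X_j) * vdm y B)).
  split.
    have := Igen B sBX cB; rewrite /gen XB => IB.
    have eB : \prod_(a in B :&: T) ('X_s - 'X_a) =
        (\prod_(j in H :&: B) ('X_s - 'X_j)) * \prod_(j in L :&: B) ('X_s - 'X_j) :> P.
      rewrite [LHS](big_setID L) /= mulrC; congr (_ * _); apply: eq_bigl => j.
        rewrite /H !inE; case: (eqVneq j i) => [->|_]; first by rewrite !andbF.
        by rewrite /=; do 4 case: (_ \in _).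
      rewrite !inE; case Lj : (j \in L); rewrite ?andbF //= (subsetP sLT) // andbT.
      by rewrite andbT.
    rewrite eB in IB; rewrite /pr (big_setID B) /=.
    set e := (-1) ^+ b; set p1 := \prod_(i in L :&: B) _; set p2 := \prod_(i in L :\: B) _.
    set p3 := \prod_(i in H :&: B) _ in IB *.
    have -> : p1 * p2 * (e * vdm y (i |: A) * (p3 * vdm y B))
      = e * p2 * (p3 * p1 * vdm y B * vdm y (i |: A)) by ring.
    exact: IM.
  have tH : \prod_(j in H :&: B) ('X_i - 'X_j) = ren t0 (\prod_(j in H :&: B) ('X_s - 'X_j)) :> P.
    rewrite rmorph_prod; apply: eq_bigr => j; rewrite in_setI => /andP[Hj _].
    by rewrite rmorphB /= !renX t0s t0E //; apply/(subsetP sTX)/(subsetP sHT).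
  rewrite -/B /gen vdmE.
  (* [A] and [B] partition [X :\ i]. The part of [prH] over [A] and the linear factors over [A]
     outside [H] form the full product occurring in [vdm y (i |: A)]. *)
  have -> : prH = (\prod_(j in H :&: B) ('X_i - 'X_j)) * (\prod_(j in H :&: A) ('X_i - 'X_j)).
    rewrite /prH (big_setID B) /=; congr (_ * _); apply: eq_bigl => j.
    rewrite in_setD in_setI andbC; case Hj: (j \in H) => //=.
    have jX : j \in X by apply/(subsetP sTX)/(subsetP sHT).
    by move: Hj; rewrite !inE negb_or jX negb_and negbK => /andP[/andP[-> _] _]; rewrite orbF.
  have -> : \prod_(a in A) ('X_i - 'X_a) = (\prod_(j in H :&: A) ('X_i - 'X_j))
      * (\prod_(j in A :&: (X :\ i :\: H)) ('X_i - 'X_j)) :> P.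
    rewrite (big_setID H) /= setIC; congr (_ * _); apply: eq_bigl => j.
    rewrite in_setI (in_setD A H) (in_setD _ H) andbC; case Aj: (j \in A) => //=.
    by rewrite (subsetP sA j Aj) andbT.
  rewrite tH; set p3 := \prod_(j in H :&: B) _.
  set pA := \prod_(j in H :&: A) _; set pA' := \prod_(j in A :&: _) _.
  have := signrMK b (1 : P); rewrite mulr1; set e := (-1) ^+ b => ee.
  have -> : e * (e * (pA * pA') * vdm y A) * (p3 * vdm y B)
      = (e * e) * (p3 * (pA * (pA' * vdm y A * vdm y B))) by ring.
  have -> : ren t0 p3 * pA * (pA' * vdm y A * vdm y B)
      = ren t0 p3 * (pA * (pA' * vdm y A * vdm y B)) by ring.
  by rewrite ee mul1r rmorphM [in RHS]rmorphM /= t0K.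
(* [g] and [g'] agree at s = i, so their difference has the factor ['X_s - 'X_i], and [i] joins
   [L]. *)
have [|g2 gg2] := @ren_identify_eq0 _ _ i s (g - g').
  by rewrite rmorphB /= t0g' -/prH -uq t0K subrr.
have eg : g = g' + ('X_s - 'X_i) * g2 by rewrite -gg2 addrC subrK.
have prU : pr (i |: L) = pr L * ('X_s - 'X_i) by rewrite /pr big_setU1 //= mulrC.
have eqg : pr L * g = pr L * g' + pr (i |: L) * g2 by rewrite eg prU; ring.
rewrite eqg; apply: ID => //; apply: IHd.
- move: cL; rewrite (cardsD1 i) !inE iL Ti /= add1n; apply: leq_ltn_trans.
  by rewrite setDDl setUC.
- by rewrite subUset sub1set Ti.
- have -> : pr (i |: L) * g2 = pr L * g - pr L * g' by rewrite eqg; ring.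
  by apply: ideal_sub (ideal_locus _ _ _ _) _ _ => //; apply: IJ.
Qed.

End LocusIdeal.

(** * Averaging over roots of unity *)

Section RootsOfUnity.
Variable C : numClosedFieldType.

Lemma prim_root_exists n : (0 < n)%N -> exists z : C, n.-primitive_root z.
Proof.
move=> n_gt0; have [r Er] := closed_field_poly_normal ('X^n - 1 : {poly C}).
move: Er; rewrite (monicP (monicXnsubC 1 n_gt0)) scale1r => Er.
have root_r x : (x \in r) = n.-unity_root x.
  by rewrite -root_prod_XsubC -Er.
have: has n.-primitive_root r.
  apply: has_prim_root => //.
  - by apply/allP => x; rewrite root_r.
  - by rewrite -separable_prod_XsubC -Er separable_Xn_sub_1 // pnatr_eq0 -lt0n.
  - by rewrite -ltnS -(size_prod_XsubC r id) -Er (size_XnsubC 1).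
by case/hasP => z _ zP; exists z.
Qed.

(** Orthogonality of characters of Z/n: off the diagonal this is a geometric sum of ratio [w] with
    [w ^+ n = 1] and [w] different from 1. *)
Lemma sum_prim_root n (z : C) a b : n.-primitive_root z ->
  \sum_(j < n) z^-1 ^+ (j * b) * z ^+ (j * a) = if (a == b %[mod n])%N then n%:R else 0.
Proof.
move=> zP; have z0 : z != 0 by rewrite (prim_root_eq0 zP) -lt0n (prim_order_gt0 zP).
pose w := z ^+ a / z ^+ b.
have -> : \sum_(j < n) z^-1 ^+ (j * b) * z ^+ (j * a) = \sum_(j < n) w ^+ j.
  apply: eq_bigr => j _.
  by rewrite /w expr_div_n exprVn -!exprM ![(j * _)%N]mulnC mulrC.
have wn : w ^+ n = 1.
  by rewrite /w expr_div_n -!exprM ![(_ * n)%N]mulnC !exprM (prim_expr_order zP) !expr1n divr1.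
rewrite -(eq_prim_root_expr zP); case: eqP => [eqab|neqab].
  rewrite /w eqab divff ?expf_neq0 //.
  by rewrite (eq_bigr (fun=> 1)) => [|j _]; rewrite ?expr1n // sumr_const card_ord.
have w1 : w - 1 != 0.
  rewrite subr_eq0; apply: contra_notN neqab => /eqP w1.
  by rewrite -[LHS](divfK (expf_neq0 b z0)) -/w w1 mul1r.
by apply: (mulfI w1); rewrite -subrX1 wn subrr mulr0.
Qed.

(** Fourier projection: orthogonality in each coordinate kills the monomials whose exponents are not
    congruent to [e]. *)
Lemma sum_twists m n (z : C) (f : {mpoly C[m]}) (e : 'I_m -> nat) v :
  n.-primitive_root z ->
  \sum_(j : {ffun 'I_m -> 'I_n})
     (\prod_i z^-1 ^+ (j i * e i)) * f.@[fun i => z ^+ j i * v i]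
  = n%:R ^+ m *
    \sum_(d <- msupp f | [forall i, (d : 'X_{1..m}) i == e i %[mod n]])
      f@_d * \prod_i v i ^+ d i.
Proof.
move=> zP.
under eq_bigr => j _ do rewrite mevalE mulr_sumr.
rewrite exchange_big /= mulr_sumr [RHS]big_mkcond /=; apply: eq_bigr => d _.
transitivity (f@_d * (\prod_i v i ^+ d i) *
   \prod_(i < m) \sum_(j < n) z^-1 ^+ (j * e i) * z ^+ (j * d i)).
  rewrite bigA_distr_bigA mulr_sumr; apply: eq_bigr => j _ /=.
  rewrite mulrCA -mulrA -!big_split /=; congr (_ * _); apply: eq_bigr => i _ /=.
  by rewrite exprMn -exprM; ring.
under [X in _ * X = _]eq_bigr => i _ do rewrite (sum_prim_root _ _ zP).
case: forallP => [eq_de|/forallP]; last first.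
  rewrite negb_forall => /existsP[i /negPf ne].
  by rewrite [X in _ * X = _](bigD1 i) //= ne mul0r mulr0.
under [X in _ * X = _]eq_bigr => i _ do rewrite eq_de.
by rewrite prodr_const card_ord mulrC.
Qed.

(** When [n] exceeds all exponents, congruence is equality, and averaging over points with root of
    unity coordinates isolates one coefficient. *)
Lemma mpoly_eq0_torus m (p : {mpoly C[m]}) :
  (forall v, (forall i, v i != 0) -> p.@[v] = 0) -> p = 0.
Proof.
move=> p0; apply/mpolyP => d; rewrite mcoeff0.
case: (boolP (d \in msupp p)) => [dp|]; last exact: memN_msupp_eq0.
have [z zP] := prim_root_exists (ltn0Sn (msize p)).
have z0 : z != 0 by rewrite (prim_root_eq0 zP).
have small d' i : d' \in msupp p -> (d' i < (msize p).+1)%N.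
  move=> /msize_mdeg_lt; rewrite mdegE (bigD1 i) //= => lt.
  by rewrite ltnS ltnW // (leq_ltn_trans _ lt) // leq_addr.
have := @sum_twists m _ z p d (fun=> 1) zP.
rewrite big1 => [|j _]; last by rewrite p0 ?mulr0 // => i; rewrite mulr1 expf_neq0.
move/esym/eqP; rewrite mulf_eq0 expf_eq0 pnatr_eq0 andbF /= => /eqP.
rewrite -big_filter (bigD1_seq d) /=; last by rewrite filter_uniq // msupp_uniq.
  rewrite [X in _ + X]big1_seq ?addr0 => [|d' /andP[ne]].
    by under eq_bigr => i _ do rewrite expr1n; rewrite big1_eq mulr1.
  rewrite mem_filter => /andP[/forallP eqd /small lt].
  case/eqP: ne; apply/mnmP => i; move: (eqd i) => /eqP.
  by rewrite !modn_small // small.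
by rewrite mem_filter dp andbT; apply/forallP.
Qed.

Lemma mpoly_eq0 m (p : {mpoly C[m]}) : (forall v, p.@[v] = 0) -> p = 0.
Proof. by move=> p0; apply: mpoly_eq0_torus. Qed.

(* Writing [f] as the sum over [e] in [(Z/n)^m] of ['X^e * f_e('X_i ^ n)],
   [component f e] is the polynomial [f_e]; here [n = n'.+1]. *)
Section Component.
Variables (m n' : nat).
Local Notation n := n'.+1.
Implicit Types (f : {mpoly C[m]}) (e : {ffun 'I_m -> 'I_n}).

Definition residue (d : 'X_{1..m}) : {ffun 'I_m -> 'I_n} := [ffun i => inZp (d i)].

Definition component f e : {mpoly C[m]} :=
  \sum_(d <- msupp f | residue d == e) f@_d *: 'X_[[multinom d i %/ n | i < m]].

Lemma residue_eqE d e : (residue d == e) = [forall i, d i == e i %[mod n]].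
Proof.
apply/eqP/forallP => [<- i | eq_de]; first by rewrite ffunE /= modn_mod.
by apply/ffunP => i; apply/val_inj; rewrite ffunE /= (eqP (eq_de i)) modn_small.
Qed.

Lemma prod_residue (S : comNzRingType) (v : 'I_m -> S) d :
  (\prod_i v i ^+ residue d i) * \prod_i (v i ^+ n) ^+ (d i %/ n) = \prod_i v i ^+ d i.
Proof.
rewrite -big_split; apply: eq_bigr => i _ /=.
by rewrite ffunE -exprM -exprD /= addnC mulnC -divn_eq.
Qed.

Lemma sum_component f :
  f = \sum_(e : {ffun 'I_m -> 'I_n}) (\prod_i 'X_i ^+ e i) * (component f e \mPo [tuple 'X_i ^+ n | i < m]).
Proof.
rewrite {1}[f]mpolyE (partition_big residue predT) //=; apply: eq_bigr => e _.
rewrite raddf_sum mulr_sumr; apply: eq_bigr => d /eqP <-.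
rewrite /= comp_mpolyZ comp_mpolyX -scalerAr; congr (_ *: _).
rewrite mpolyXE_id -prod_residue; congr (_ * _); apply: eq_bigr => i _.
by rewrite tnth_mktuple mnmE.
Qed.

Lemma meval_component f e v :
  (\prod_i v i ^+ e i) * (component f e).@[fun i => v i ^+ n]
  = \sum_(d <- msupp f | residue d == e) f@_d * \prod_i v i ^+ d i.
Proof.
rewrite raddf_sum mulr_sumr; apply: eq_bigr => d /eqP <-.
rewrite /= mevalZ mevalX mulrCA; congr (_ * _); rewrite -[in RHS]prod_residue; congr (_ * _).
by apply: eq_bigr => i _; rewrite mnmE.
Qed.

(** Up to the factor n^m the left side is a combination of twisted values of [f], which all vanish.
    The monomial stays because coordinates of [v] may be 0. *)
Lemma component_vanish f e v :
  (forall t, (forall i, t i ^+ n = 1) -> f.@[fun i => t i * v i] = 0) ->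
  (\prod_i v i ^+ e i) * (component f e).@[fun i => v i ^+ n] = 0.
Proof.
move=> f0; have [z zP] := prim_root_exists (ltn0Sn n').
rewrite meval_component; under eq_bigl => d do rewrite residue_eqE.
have := @sum_twists m _ z f (fun i => e i) v zP; rewrite big1 => [|j _]; last first.
  by rewrite f0 ?mulr0 // => i; rewrite exprAC (prim_expr_order zP) expr1n.
by move/esym/eqP; rewrite mulf_eq0 expf_eq0 pnatr_eq0 andbF /= => /eqP.
Qed.

End Component.
End RootsOfUnity.

(** * Hyperplanes in a space of row vectors *)

Lemma dim_rowv (C : fieldType) m : \dim (fullv : {vspace 'rV[C]_m}) = m.
Proof. by rewrite dimvf dim_matrix; apply: mul1n. Qed.

Lemma dim_le_rowv (C : fieldType) m (U : {vspace 'rV[C]_m}) : (\dim U <= m)%N.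
Proof. by apply: leq_trans (dimvS (subvf U)) _; rewrite dim_rowv. Qed.

Section Hyperplanes.
Variables (C : fieldType) (m : nat).
Local Notation V := 'rV[C]_m.

Definition functional_kernel (a : 'cV[C]_m) : {vspace V} :=
  lker (linfun (mulmxr a : V -> 'rV_1)).

Lemma mem_functional_kernel a (v : V) :
  (v \in functional_kernel a) = (\sum_k v ord0 k * a k ord0 == 0).
Proof.
rewrite memv_ker lfunE /=; apply/eqP/eqP => [/rowP/(_ ord0)|va]; first by rewrite !mxE.
by apply/rowP => i; rewrite !ord1 !mxE.
Qed.

Lemma dim_functional_kernel a : a != 0 -> (\dim (functional_kernel a)).+1 = m.
Proof.
move=> a0; have := limg_ker_dim (linfun (mulmxr a : V -> 'rV_1)) fullv.
rewrite capfv dim_rowv => dimE; rewrite -[RHS]dimE -addn1; congr (_ + _)%N.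
apply/eqP; rewrite eq_sym eqn_leq; apply/andP; split.
  exact: dim_le_rowv.
rewrite lt0n dimv_eq0; apply: contra a0 => /eqP img0.
apply/eqP/colP => k; rewrite mxE.
have : linfun (mulmxr a : V -> 'rV_1) (delta_mx ord0 k) \in limg (linfun (mulmxr a : V -> 'rV_1)).
  by rewrite memv_img ?memvf.
rewrite img0 memv0 lfunE /= -rowE => /eqP/rowP/(_ ord0).
by rewrite !mxE.
Qed.

Lemma dim_cap_hyperplanes (U W : {vspace V}) :
  (\dim U).+1 = m -> (\dim W).+1 = m -> U != W -> (\dim (U :&: W) + 2)%N = m.
Proof.
move=> dU dW neUW.
suff dUW : \dim (U + W) = m by have := dimv_sum_cap U W; lia.
have ltU : (\dim U < \dim (U + W))%N.
  rewrite ltnNge; apply: contra neUW => le.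
  have /eqP eqU : U == (U + W)%VS by rewrite eqEdim addvSl.
  rewrite eq_sym eqEdim -ltnS dU dW leqnn andbT.
  by rewrite [in X in (_ <= X)%VS]eqU addvSr.
by have := dim_le_rowv (U + W); lia.
Qed.

Definition eq_hyperplane (i j : 'I_m) (z : C) : {vspace V} :=
  functional_kernel (\col_k ((k == i)%:R - z * (k == j)%:R)).

Lemma mem_eq_hyperplane i j z (v : V) :
  (v \in eq_hyperplane i j z) = (v ord0 i == z * v ord0 j).
Proof.
rewrite mem_functional_kernel -[RHS]subr_eq0; congr (_ == _).
have sum_delta l (c : C) : \sum_k v ord0 k * (c * (k == l)%:R) = c * v ord0 l.
  rewrite (bigD1 l) //= eqxx mulr1 big1 ?addr0 1?mulrC // => k /negPf->.
  by rewrite !mulr0.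
rewrite -(sum_delta j) -[v ord0 i]mul1r -(sum_delta i) -sumrB; apply: eq_bigr => k _.
by rewrite mxE mul1r mulrBr.
Qed.

Lemma dim_eq_hyperplane i j z : i != j -> (\dim (eq_hyperplane i j z)).+1 = m.
Proof.
move=> nij; apply: dim_functional_kernel; apply/eqP => /colP/(_ i)/eqP.
by rewrite !mxE eqxx (negPf nij) mulr0 subr0 oner_eq0.
Qed.

End Hyperplanes.

(** * The hyperplanes of the arrangement and the points of its locus *)

Section LinearFactors.
Variables (C : numClosedFieldType) (N n : nat).
Hypothesis n_gt0 : (0 < n)%N.
Local Notation m := N.+1.
Local Notation P := {mpoly C[m]}.

Lemma homog1E (l : P) : l \is 1.-homog -> l = \sum_i l@_U_(i) *: 'X_i.
Proof.
move=> hl; apply/mpolyP => d; rewrite raddf_sum /=.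
under eq_bigr => i _ do rewrite mcoeffZ mcoeffX.
have [/eqP|ne1] := boolP (mdeg d == 1%N); last first.
  rewrite (dhomog_nemf_coeff hl ne1) big1 // => i _.
  by case: eqP => [Ed|_]; [rewrite -Ed mdeg1 in ne1|rewrite mulr0].
move/eqP/mdeg1P => [i /eqP ->]; rewrite (bigD1 i) //= eqxx mulr1 big1 ?addr0 // => j nji.
case: eqP => [/mnmP/(_ j)|]; rewrite ?mulr0 //.
by rewrite !mnm1E eqxx eq_sym (negPf nji).
Qed.

(** Over the domain of polynomials, X^n - q^n has at most n roots, and for nonzero [q] the multiples
    of [q] by n-th roots of unity already are n roots. *)
Lemma exprn_eq_root (p q : P) : p ^+ n = q ^+ n ->
  exists2 z : C, z ^+ n = 1 & p = z%:MP * q.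
Proof.
move=> pq; have [q0|q0] := eqVneq q 0.
  exists 1; rewrite ?expr1n // q0 mulr0; apply/eqP.
  by have /eqP := pq; rewrite q0 expr0n gtn_eqF // expf_eq0 n_gt0.
have [z zP] := prim_root_exists C n_gt0.
pose rs := [seq (z ^+ k)%:MP * q | k <- iota 0 n].
have [/mapP[k _ ->]|prs] := boolP (p \in rs).
  by exists (z ^+ k); rewrite // exprAC (prim_expr_order zP) expr1n.
have : (size (p :: rs) < size ('X^n - (q ^+ n)%:P)%R)%N.
  apply: max_poly_roots.
  - by rewrite -size_poly_eq0 size_XnsubC.
  - rewrite /= {1}/root !hornerE pq subrr eqxx /=; apply/allP => _ /mapP[k _ ->].
    by rewrite /root !hornerE exprMn -rmorphXn exprAC (prim_expr_order zP) expr1n rmorph1 mul1r subrr.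
  - rewrite /= prs map_inj_in_uniq ?iota_uniq // => k l; rewrite !mem_iota !add0n /= => kn ln.
    move/(mulIf q0)/(fmorph_inj (@mpolyC m C))/eqP; rewrite (eq_prim_root_expr zP) !modn_small //.
    by move/eqP.
by rewrite /= size_map size_iota size_XnsubC // ltnn.
Qed.

Lemma fermat_poly_factor i j z : i != j -> z ^+ n = 1 ->
  exists q, fermat_poly C N n = q * ('X_i - z *: 'X_j).
Proof.
have key (a b : 'I_m) (x y : P) : (a < b)%N ->
    (exists q, 'X_a ^+ n - 'X_b ^+ n = q * (x - y)) ->
    exists q, fermat_poly C N n = q * (x - y).
  move=> ltab [q Eq]; rewrite /fermat_poly (bigD1 b) //= (bigD1 a) //= Eq.
  by eexists; rewrite -mulrA mulrAC; reflexivity.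
have zX (j' : 'I_m) : z ^+ n = 1 -> (z *: 'X_j' : P) ^+ n = 'X_j' ^+ n.
  by move=> zn; rewrite exprZn zn scale1r.
move=> nij zn; case: (ltngtP i j) => [lt|lt|/val_inj eij]; last by rewrite eij eqxx in nij.
- apply: (key i j) => //; eexists; rewrite -(zX j zn) subrXX mulrC; reflexivity.
- apply: (key j i) => //; eexists.
  by rewrite -opprB -(zX j zn) subrXX mulrC -mulNr; reflexivity.
Qed.

Lemma eq_hyperplane_fermat i j z : i != j -> z ^+ n = 1 ->
  fermat_hyperplane n (@eq_hyperplane C m i j z).
Proof.
move=> nij zn; exists ('X_i - z *: 'X_j).
  split.
  - apply/eqP => /mpolyP/(_ U_(i)%MM)/eqP.
    rewrite mcoeffB mcoeffZ !mcoeffX eqxx mcoeff0.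
    case: (U_(j)%MM =P U_(i)%MM) => [/mnmP/(_ i)|_]; last by rewrite mulr0 subr0 oner_eq0.
    by rewrite !mnm1E eqxx eq_sym (negPf nij).
  - by rewrite rpredB ?rpredZ // dhomogX /= mdeg1.
  - exact: fermat_poly_factor.
move=> v; rewrite mem_eq_hyperplane /eval_at mevalB mevalZ !mevalXU -subr_eq0.
by split=> /eqP.
Qed.

(** The substitution [t] solves [l] = 0 for one variable, so it kills the Fermat polynomial and
    hence some x_i^n - x_j^n. Then x_i = z x_j holds on [H], and dimensions agree. *)
Lemma fermat_hyperplaneE (H : {vspace 'rV[C]_m}) : fermat_hyperplane n H ->
  exists i j z, [/\ i != j, z ^+ n = 1 & H = eq_hyperplane i j z].
Proof.
case=> l [l0 hl [q Fq]] memH; have lE := homog1E hl.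
have [p lp] : exists p, l@_U_(p) != 0.
  apply/existsP; apply: contraNT l0; rewrite negb_exists => /forallP l0.
  by rewrite lE big1 // => i _; have /eqP-> := negbNE (l0 i); rewrite scale0r.
have evalE (v : 'rV_m) : eval_at l v = \sum_k v ord0 k * l@_U_(k).
  rewrite /eval_at {1}lE raddf_sum; apply: eq_bigr => k _.
  by rewrite /= mevalZ mevalXU mulrC.
pose t := [tuple (if i == p then 'X_p - (l@_U_(p))^-1 *: l else 'X_i : P) | i < m].
have tX i : 'X_i \mPo t = if i == p then 'X_p - (l@_U_(p))^-1 *: l else 'X_i.
  by rewrite comp_mpolyXU -tnth_nth tnth_mktuple.
have tl : l \mPo t = 0.
  rewrite {1}lE raddf_sum /= (bigD1 p) //= comp_mpolyZ tX eqxx.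
  rewrite scalerBr scalerA divff // scale1r {2}lE (bigD1 p) //= opprD addrA subrr add0r.
  rewrite addrC [X in X - _](eq_bigr (fun i => l@_U_(i) *: 'X_i)) ?subrr // => i /negPf np.
  by rewrite comp_mpolyZ tX np.
have eval_t (g : P) (v : 'rV_m) : v \in H -> (g \mPo t).@[fun i => v ord0 i] = eval_at g v.
  move/memH => lv; rewrite comp_mpoly_meval; apply: meval_eq => i.
  rewrite tnth_mktuple; case: eqP => [->|_]; last by rewrite mevalXU.
  by rewrite mevalB mevalZ mevalXU -/(eval_at l v) lv mulr0 subr0.
have : fermat_poly C N n \mPo t = 0 by rewrite Fq rmorphM /= tl mulr0.
move/eqP; rewrite rmorph_prod prodf_seq_eq0 => /hasP[j _ /=].
rewrite rmorph_prod prodf_seq_eq0 => /hasP[i _ /andP[ltij]].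
rewrite rmorphB !rmorphXn /= subr_eq0 => /eqP/exprn_eq_root[z zn Eij].
have nij : i != j by apply: contraTneq ltij => ->; rewrite ltnn.
exists i, j, z; split=> //; apply/eqP; rewrite eqEdim; apply/andP; split.
  apply/subvP => v Hv; rewrite mem_eq_hyperplane.
  have := eval_t 'X_i v Hv; rewrite Eij mevalM mevalC (eval_t _ _ Hv).
  by rewrite /eval_at !mevalXU => ->.
rewrite -ltnS dim_eq_hyperplane //.
suff -> : H = functional_kernel (\col_k l@_U_(k)).
  rewrite dim_functional_kernel //; apply: contra lp => /eqP/colP/(_ p).
  by rewrite !mxE => ->.
apply/vspaceP => v; rewrite mem_functional_kernel; under eq_bigr => k _ do rewrite mxE.
rewrite -evalE; apply/idP/eqP => /memH //.
Qed.

Definition two_zeros (v : 'rV[C]_m) :=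
  exists a b, [/\ a != b, v ord0 a = 0 & v ord0 b = 0].
Definition three_equal_powers (v : 'rV[C]_m) :=
  exists a b c, [/\ uniq [:: a; b; c], v ord0 a ^+ n = v ord0 b ^+ n
                  & v ord0 b ^+ n = v ord0 c ^+ n].

(** Two distinct hyperplanes on the same pair of indices force two zeros; one shared index chains
    three equal powers. *)
Lemma eq_hyperplane_inter (v : 'rV[C]_m) i j z k l w :
  i != j -> k != l -> z ^+ n = 1 -> w ^+ n = 1 ->
  v \in eq_hyperplane i j z -> v \in eq_hyperplane k l w ->
  eq_hyperplane i j z != eq_hyperplane k l w ->
  [\/ two_zeros v, three_equal_powers v | [&& i != k, i != l, j != k & j != l]].
Proof.
rewrite !mem_eq_hyperplane => nij nkl zn wn /eqP vi /eqP vk ne.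
have pi : v ord0 i ^+ n = v ord0 j ^+ n by rewrite vi exprMn zn mul1r.
have pk : v ord0 k ^+ n = v ord0 l ^+ n by rewrite vk exprMn wn mul1r.
have three a b c : a != b -> a != c -> b != c -> v ord0 a ^+ n = v ord0 b ^+ n ->
    v ord0 b ^+ n = v ord0 c ^+ n -> three_equal_powers v.
  by move=> nab nac nbc ab bc; exists a, b, c; rewrite /= !inE negb_or nab nac nbc.
have zeros x y : x != y -> v ord0 i = x * v ord0 j -> v ord0 i = y * v ord0 j -> two_zeros v.
  move=> nxy vx vy; have vj : v ord0 j = 0.
    apply: contraNeq nxy => vj; apply/eqP/(mulIf vj); by rewrite -vx.
  by exists i, j; rewrite nij vx vj mulr0.
have [eik|nik] := eqVneq i k.
  subst k; have [ejl|njl] := eqVneq j l.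
    by subst l; apply: Or31; apply: (zeros z w) => //; apply: contraNneq ne => ->.
  by apply: Or32; apply: (three j i l); rewrite // eq_sym.
have [eil|nil] := eqVneq i l.
  subst l; have [ejk|njk] := eqVneq j k; last first.
    by apply: Or32; apply: (three j i k); rewrite // eq_sym.
  (* For the swapped pair the second equation is inverted to x_i = w^-1 x_j. *)
  subst k; have w0 : w != 0.
    by apply: contra_eq_neq wn => ->; rewrite expr0n gtn_eqF // eq_sym oner_neq0.
  have viw : v ord0 i = w^-1 * v ord0 j by rewrite vk mulKf.
  apply: Or31; apply: (zeros z w^-1) => //; apply: contraNneq ne => ->.
  apply/eqP/vspaceP => u; rewrite !mem_eq_hyperplane.
  by apply/eqP/eqP => ->; rewrite ?mulVKf ?mulKf.
have [ejk|njk] := eqVneq j k.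
  by subst k; apply: Or32; apply: (three i j l).
have [ejl|njl] := eqVneq j l; last exact: Or33.
by subst l; apply: Or32; apply: (three i j k).
Qed.

Lemma fermat_locusW (v : 'rV[C]_m) : fermat_locus n v -> two_zeros v \/ three_equal_powers v.
Proof.
case=> _ [W [dimW [H1 [H2 [H3 [uH [fH1 sWH1] [fH2 sWH2] [fH3 sWH3]]]]]] vW].
move: uH; rewrite /= !inE negb_or andbT => /andP[/andP[ne12 ne13] ne23].
have [i1 [j1 [z1 [n1 z1n E1]]]] := fermat_hyperplaneE fH1.
have [i2 [j2 [z2 [n2 z2n E2]]]] := fermat_hyperplaneE fH2.
have [i3 [j3 [z3 [n3 z3n E3]]]] := fermat_hyperplaneE fH3.
subst H1 H2 H3.
have vH1 := subvP sWH1 _ vW; have vH2 := subvP sWH2 _ vW; have vH3 := subvP sWH3 _ vW.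
(* Outside the two cases the three index pairs are pairwise disjoint. *)
have [||/and4P[_ _ _ _]] := eq_hyperplane_inter n1 n2 z1n z2n vH1 vH2 ne12; [by left|by right|].
have [||/and4P[ni13 _ nj13 _]] := eq_hyperplane_inter n1 n3 z1n z3n vH1 vH3 ne13; [by left|by right|].
have [||/and4P[ni23 _ nj23 _]] := eq_hyperplane_inter n2 n3 z2n z3n vH2 vH3 ne23; [by left|by right|].
have eW : W = (eq_hyperplane i1 j1 z1 :&: eq_hyperplane i2 j2 z2)%VS.
  apply/eqP; rewrite eqEdim subv_cap sWH1 sWH2 /=.
  by rewrite -(leq_add2r 2) dimW dim_cap_hyperplanes ?dim_eq_hyperplane.
(* Three independent equations would cut out a space smaller than [W]. *)
have: delta_mx ord0 i3 \in W.
  rewrite eW memv_cap !mem_eq_hyperplane !mxE eqxx /=.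
  by rewrite !(negPf ni13, negPf nj13, negPf ni23, negPf nj23) !mulr0 eqxx.
move/(subvP sWH3); rewrite mem_eq_hyperplane !mxE !eqxx /= [j3 == _]eq_sym (negPf n3) mulr0.
by rewrite oner_eq0.
Qed.

Lemma eq_hyperplane_triple (H1 H2 H3 : {vspace 'rV[C]_m}) (v : 'rV[C]_m) :
  fermat_hyperplane n H1 -> fermat_hyperplane n H2 -> fermat_hyperplane n H3 ->
  uniq [:: H1; H2; H3] -> (H1 :&: H2 <= H3)%VS ->
  v \in H1 -> v \in H2 -> v != 0 -> fermat_locus n v.
Proof.
move=> fH1 fH2 fH3 uH sub v1 v2 v0; split=> //.
exists (H1 :&: H2)%VS; last by rewrite memv_cap v1.
have [i1 [j1 [z1 [n1 _ E1]]]] := fermat_hyperplaneE fH1.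
have [i2 [j2 [z2 [n2 _ E2]]]] := fermat_hyperplaneE fH2.
split; last by exists H1, H2, H3; split=> //; split=> //; rewrite ?capvSl ?capvSr.
have ne12 : H1 != H2 by move: uH; rewrite /= !inE negb_or => /andP[/andP[]].
by rewrite E1 E2 dim_cap_hyperplanes ?dim_eq_hyperplane // -E1 -E2.
Qed.

(** As n is at least 3, the hyperplanes x_a = z^k x_b for k = 0, 1, 2 are distinct, and all contain
    x_a = x_b = 0. *)
Lemma fermat_locus_two_zeros (v : 'rV[C]_m) : (2 < n)%N ->
  v != 0 -> two_zeros v -> fermat_locus n v.
Proof.
move=> n_gt2 v0 [a [b [nab va vb]]].
have [z zP] := prim_root_exists C n_gt0.
have zn k : (z ^+ k) ^+ n = 1 by rewrite exprAC (prim_expr_order zP) expr1n.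
have ne k l : (k < n)%N -> (l < n)%N -> k != l ->
    eq_hyperplane a b (z ^+ k) != eq_hyperplane a b (z ^+ l).
  move=> kn ln; apply: contraNneq => /vspaceP/(_ (z ^+ k *: delta_mx ord0 a + delta_mx ord0 b)).
  rewrite !mem_eq_hyperplane !mxE !eqxx (negPf nab) [b == a]eq_sym (negPf nab) /=.
  rewrite mulr1n mulr0n !mulr0 mulr1 add0r !addr0 !mulr1 eqxx => /esym.
  by rewrite (eq_prim_root_expr zP) !modn_small.
have mem (u : 'rV[C]_m) k : u ord0 a = 0 -> u ord0 b = 0 -> u \in eq_hyperplane a b (z ^+ k).
  by move=> ua ub; rewrite mem_eq_hyperplane ua ub mulr0.
apply: (@eq_hyperplane_triple (eq_hyperplane a b (z ^+ 0)) (eq_hyperplane a b (z ^+ 1))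
         (eq_hyperplane a b (z ^+ 2))); rewrite ?mem //; try exact: eq_hyperplane_fermat.
  by rewrite /= !inE negb_or !ne //; lia.
apply/subvP => u; rewrite memv_cap !mem_eq_hyperplane expr0 expr1 mul1r => /andP[/eqP -> ].
rewrite -subr_eq0 -{1}[u _ _]mul1r -mulrBl mulf_eq0 subr_eq0 eq_sym => /orP[z1|/eqP ->].
  by have := prim_order_dvd zP 1; rewrite expr1 z1 dvdn1 => /eqP nE; rewrite nE in n_gt2.
by rewrite mulr0.
Qed.

(** The ratios [r i j] of nonzero coordinates are n-th roots of unity, and [r a b * r b c = r a c]
    puts the third hyperplane through the intersection of the first two. *)
Lemma fermat_locus_three_equal_powers (v : 'rV[C]_m) :
  (forall i, v ord0 i != 0) -> three_equal_powers v -> fermat_locus n v.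
Proof.
move=> v0 [a [b [c [/= uabc ab bc]]]].
move: uabc; rewrite !inE negb_or andbT => /andP[/andP[nab nac] nbc].
pose r i j := v ord0 i / v ord0 j.
have rn i j : v ord0 i ^+ n = v ord0 j ^+ n -> r i j ^+ n = 1.
  by move=> eij; rewrite expr_div_n eij divff ?expf_neq0.
have r0 i j : r i j != 0 by rewrite mulf_neq0 ?invr_eq0.
have mem i j : v \in eq_hyperplane i j (r i j).
  by rewrite mem_eq_hyperplane divfK.
apply: (@eq_hyperplane_triple (eq_hyperplane a b (r a b)) (eq_hyperplane b c (r b c))
         (eq_hyperplane a c (r a c))); rewrite ?mem //;
  try (by apply: eq_hyperplane_fermat; rewrite ?rn // ab).
- have delta i j (l : 'I_m) : (delta_mx ord0 l \in eq_hyperplane i j (r i j))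
      = ((l == i)%:R == r i j * (l == j)%:R :> C).
    by rewrite mem_eq_hyperplane !mxE /= ![_ == l]eq_sym.
  rewrite /= !inE negb_or andbT; apply/andP; split; first (apply/andP; split).
  + apply/eqP => /vspaceP/(_ (delta_mx ord0 c)); rewrite !delta eqxx.
    rewrite ![c == _]eq_sym (negPf nac) (negPf nbc) mulr0 mulr1 eqxx => /esym/eqP/esym/eqP.
    by rewrite (negPf (r0 _ _)).
  + apply/eqP => /vspaceP/(_ (delta_mx ord0 c)); rewrite !delta eqxx.
    rewrite ![c == _]eq_sym (negPf nac) (negPf nbc) mulr0 mulr1 eqxx => /esym/eqP/esym/eqP.
    by rewrite (negPf (r0 _ _)).
  + apply/eqP => /vspaceP/(_ (delta_mx ord0 a)); rewrite !delta eqxx.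
    by rewrite (negPf nab) (negPf nac) !mulr0 eqxx oner_eq0.
- apply/subvP => u; rewrite memv_cap !mem_eq_hyperplane => /andP[/eqP -> /eqP ->].
  by rewrite /r !mulrA divfK.
- by apply: contraNneq (v0 a) => ->; rewrite mxE.
Qed.

End LinearFactors.

(** * Brackets as Vandermonde products, and spans *)

Lemma ltn_enum_val k (A : {set 'I_k}) (p q : 'I_#|A|) :
  (enum_val p < enum_val q)%N = (p < q)%N.
Proof.
have lt (i j : 'I_#|A|) : (i < j)%N -> (enum_val i < enum_val j)%N.
  move=> ltij; have x0 := enum_val i.
  have srt : sorted ltn (map val (enum A)).
    apply: (subseq_sorted ltn_trans) (iota_ltn_sorted 0 k).
    rewrite -val_enum_ord; apply: map_subseq; rewrite {1}/enum_mem -enumT.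
    exact: filter_subseq.
  rewrite !(enum_val_nth x0).
  have := sorted_ltn_nth ltn_trans 0%N srt; move/(_ i j).
  rewrite !inE !size_map -!cardE => /(_ (ltn_ord _) (ltn_ord _) ltij).
  by rewrite !(nth_map x0) -?cardE.
case: (ltngtP p q) => [/lt -> //| /lt | /val_inj ->]; last by rewrite ltnn.
by move/ltnW; rewrite leqNgt => /negPf.
Qed.

(** No sign arises: [enum] lists a set in increasing order, so positions and elements are ordered
    alike. *)
Lemma bracket_vdm k (S : comNzRingType) n (y : 'I_k -> S) (A : {set 'I_k}) :
  bracket n [seq y i | i <- enum A] = vdm (fun i => y i ^+ n) A.
Proof.
rewrite /bracket; set s := map _ _.
have ss : size s = #|A| by rewrite size_map -cardE.
transitivity (\prod_(0 <= q < size s) \prod_(0 <= p < size s | (p < q)%N)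
    (s`_p ^+ n - s`_q ^+ n)).
  by rewrite big_mkord; apply: eq_bigr => q _; rewrite big_mkord.
have sE (p : 'I_#|A|) : s`_p = y (enum_val p).
  by rewrite (nth_map (enum_val p)) -?cardE // -enum_val_nth.
rewrite ss big_mkord /vdm [RHS]big_enum_val /=. apply: eq_bigr => q _.
rewrite big_mkord big_mkcond [RHS]big_mkcondr [RHS]big_enum_val /=.
by apply: eq_bigr => p _; rewrite /= ltn_enum_val !sE.
Qed.

Lemma vdm_lift k (S : comNzRingType) (y : 'I_k.+1 -> S) (B : {set 'I_k}) :
  vdm y [set lift ord0 i | i in B] = vdm (fun i => y (lift ord0 i)) B.
Proof.
rewrite /vdm big_imset /=; last by move=> i j _ _; apply: lift_inj.
apply: eq_bigr => q _; rewrite big_mkcondr big_imset /=; last by move=> i j _ _; apply: lift_inj.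
by rewrite -big_mkcondr.
Qed.

Lemma ideal_fermat (C : fieldType) N n : ideal (@fermat_ideal C N n).
Proof.
split=> [v _|p q Ip Iq v Lv|r p Ip v Lv]; rewrite /eval_at.
- exact: meval0.
- by rewrite mevalD [X in X + _]Ip // [X in _ + X]Iq // addr0.
- by rewrite mevalM [X in _ * X]Ip // mulr0.
Qed.

Definition span (S : comNzRingType) (T : finType) (P : pred T) (g : T -> S) (f : S) : Prop :=
  exists c : T -> S, f = \sum_(t | P t) c t * g t.

Lemma ideal_span (S : comNzRingType) (T : finType) (P : pred T) (g : T -> S) : ideal (span P g).
Proof.
split=> [|_ _ [c ->] [d ->]|r _ [c ->]].
- by exists (fun=> 0); rewrite big1 // => t _; rewrite mul0r.
- by exists (fun t => c t + d t); rewrite -big_split; apply: eq_bigr => t _; rewrite mulrDl.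
- by exists (fun t => r * c t); rewrite mulr_sumr; apply: eq_bigr => t _; rewrite mulrA.
Qed.

Lemma mem_span (S : comNzRingType) (T : finType) (P : pred T) (g : T -> S) t : P t -> span P g (g t).
Proof.
move=> Pt; exists (fun u => (u == t)%:R); rewrite (bigD1 t) //= eqxx mul1r big1 ?addr0 //.
by move=> u /andP[_ /negPf->]; rewrite mul0r.
Qed.

Lemma ideal_sum (S : comNzRingType) (I : S -> Prop) (T : Type) (r : seq T) (P : pred T) (F : T -> S) :
  ideal I -> (forall t, P t -> I (F t)) -> I (\sum_(t <- r | P t) F t).
Proof. by case=> I0 ID _ IF; apply: big_ind. Qed.

(** * Generators of the Fermat ideal *)

Section Generators.
Variables (C : numClosedFieldType) (N n' : nat).
Hypothesis N_ge2 : (2 <= N)%N.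
Local Notation n := n'.+1.
Local Notation m := N.+1.
Hypothesis n_ge3 : (2 < n)%N.
Local Notation P := {mpoly C[m]}.
Local Notation Y := (fun i : 'I_m => 'X_i ^+ n : P).

Lemma fermat_genE (A : {set 'I_m}) :
  fermat_gen C n A = (\prod_(i in A) 'X_i) * vdm Y A * vdm Y (~: A).
Proof. by rewrite /fermat_gen !bracket_vdm. Qed.

Lemma fermat_gen_in_ideal (A : {set 'I_m}) : fermat_ideal n (fermat_gen C n A).
Proof.
move=> v Lv; rewrite /eval_at fermat_genE !mevalM !(rmorph_vdm (meval _)) rmorph_prod /=.
under eq_bigr => i _ do rewrite mevalXU.
pose w i := v ord0 i ^+ n.
have vdmE B : vdm (fun i => ('X_i ^+ n).@[fun j => v ord0 j]) B = vdm w B.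
  by apply: eq_vdm => i; rewrite rmorphXn /= mevalXU.
rewrite !vdmE; have [[a [b [nab va vb]]]|[a [b [c [uabc ab bc]]]]] := fermat_locusW (ltn0Sn _) Lv.
  have zero i : v ord0 i = 0 -> i \in A -> \prod_(j in A) v ord0 j = 0.
    by move=> vi Ai; rewrite (bigD1 i) //= vi mul0r.
  have [Aa|Aa] := boolP (a \in A); first by rewrite (zero a) // !mul0r.
  have [Ab|Ab] := boolP (b \in A); first by rewrite (zero b) // !mul0r.
  by rewrite (@vdm_eq0 _ _ w (~: A) a b) ?mulr0 ?inE // /w va vb.
(* With [T] empty the linear factors disappear and only the two brackets remain. *)
have := @gen_eq0_triple _ _ w 0 setT set0 A a b c (subsetT _) uabc ab bc.
by rewrite /gen setI0 big_set0 mul1r setTD -mulrA => ->; rewrite mulr0.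
Qed.

Section FixedComponent.
Variables (f : P) (e : {ffun 'I_m -> 'I_n}).
Hypothesis f_in : fermat_ideal n f.
Local Notation h := (component f e).

(** The monomial x^e does not vanish at [v], since coordinates with positive exponent are nonzero;
    it can be cancelled from [component_vanish]. *)
Lemma component_eval0 v : (forall i, (0 < e i)%N -> v i != 0) ->
  (forall t, (forall i, t i ^+ n = 1) -> fermat_locus n (\row_i (t i * v i))) ->
  h.@[fun i => v i ^+ n] = 0.
Proof.
move=> v0 Lv; have /eqP: (\prod_i v i ^+ e i) * h.@[fun i => v i ^+ n] = 0.
  apply: component_vanish => t t1; rewrite -[RHS](f_in (Lv t t1)).
  by apply: meval_eq => i; rewrite mxE.
rewrite mulf_eq0 => /orP[|/eqP//]; rewrite prodf_seq_eq0 => /hasP[i _ /=].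
by rewrite expf_eq0 => /andP[/v0/negPf->].
Qed.

Lemma unity_neq0 (t : C) : t ^+ n = 1 -> t != 0.
Proof. by move=> t1; apply: contra_eq_neq t1 => ->; rewrite expr0n /= eq_sym oner_neq0. Qed.

(** Collapsing the three indices turns the claim into a polynomial identity, tested on the torus.
    There n-th roots of the coordinates are nonzero and give points of the locus. *)
Lemma component_eq0_triple u a b c :
  uniq [:: a; b; c] -> u a = u b -> u b = u c -> h.@[u] = 0.
Proof.
move=> uabc uab ubc; pose r i := if i \in [:: a; b; c] then a else i.
have ren_eval w : (ren r h).@[w] = h.@[fun i => w (r i)].
  rewrite /ren comp_mpoly_meval; apply: meval_eq => i.
  by rewrite tnth_mktuple mevalXU.
have -> : h.@[u] = (ren r h).@[u].
  rewrite ren_eval; apply: meval_eq => i; rewrite /r.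
  by rewrite !inE; case: ifP => // /or3P[] /eqP -> //; rewrite uab.
suff -> : ren r h = 0 by rewrite meval0.
apply: mpoly_eq0_torus => w w0; rewrite ren_eval.
pose v i := n.-root (w (r i)).
have vn i : v i ^+ n = w (r i) by apply: rootCK.
have v0 i : v i != 0 by rewrite rootC_eq0.
rewrite -(meval_eq _ vn); apply: component_eval0 => // t t1.
apply: fermat_locus_three_equal_powers => // [i|].
  by rewrite mxE mulf_neq0 // unity_neq0.
by exists a, b, c; rewrite !mxE !exprMn !t1 !mul1r !vn /r !inE !eqxx ?orbT.
Qed.

Lemma component_eq0_pair u a b :
  a != b -> e a = 0 -> e b = 0 -> u a = 0 -> u b = 0 -> h.@[u] = 0.
Proof.
move=> nab ea eb ua ub; pose ab i := i \in [:: a; b].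
pose g := h \mPo [tuple (if ab i then 0 else 'X_i : P) | i < m].
have g_eval w : g.@[w] = h.@[fun i => if ab i then 0 else w i].
  rewrite comp_mpoly_meval; apply: meval_eq => i.
  by rewrite tnth_mktuple; case: ifP; rewrite ?meval0 ?mevalXU.
have -> : h.@[u] = g.@[u].
  rewrite g_eval; apply: meval_eq => i; rewrite /ab !inE.
  by case: ifP => // /orP[] /eqP ->.
suff -> : g = 0 by rewrite meval0.
apply: mpoly_eq0_torus => w w0; rewrite g_eval.
pose v i := if ab i then 0 else n.-root (w i).
have vn i : v i ^+ n = if ab i then 0 else w i.
  by rewrite /v; case: ifP => _; [rewrite expr0n|apply: rootCK].
rewrite -(meval_eq _ vn); apply: component_eval0 => [i|t t1].
  rewrite /v; case: ifP => [|_ _]; last by rewrite rootC_eq0.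
  by rewrite /ab !inE => /orP[] /eqP ->; rewrite ?ea ?eb.
apply: fermat_locus_two_zeros => //; last first.
  by exists a, b; rewrite !mxE /v /ab !inE !eqxx ?orbT !mulr0.
(* As [N] is at least 2, a third index exists; its coordinate is nonzero, so the vector represents a
   projective point. *)
have [c abc] : exists c, ~~ ab c.
  apply/existsP; rewrite -negb_forall; apply/negP => /forallP all_ab.
  have := subset_leq_card (_ : [set: 'I_m] \subset [set a; b]).
  rewrite cardsT card_ord cards2 nab => /(_ _); rewrite ltnS leqNgt N_ge2 => contra.
  suff: false by []; apply: contra; apply/subsetP => i _.
  by have := all_ab i; rewrite /ab !inE.
apply/eqP => /rowP/(_ c)/eqP; rewrite !mxE /v (negPf abc) mulf_eq0 (negPf (unity_neq0 (t1 c))).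
by rewrite rootC_eq0 //= (negPf (w0 c)).
Qed.

(** The extra variable has index [ord0] and the original ones have lifted indices; [T] collects
    those with exponent 0 in x^e. *)
Local Notation k := m.+1.
Local Notation X := [set lift ord0 i | i in [set: 'I_m]].
Local Notation T := [set lift ord0 i | i in [set i | e i == 0]].
Local Notation y := (fun i : 'I_k => 'X_i : {mpoly C[k]}).

(* The translation turns the value 0 into the value of the new variable
   ['X_ord0]. *)
Local Notation F := (h \mPo [tuple ('X_(lift ord0 i) - 'X_ord0 : {mpoly C[k]}) | i < m]).

Definition specialize : {mpoly C[k]} -> P :=
  comp_mpoly [tuple (if unlift ord0 i is Some j then 'X_j ^+ n else 0 : P) | i < k].

HB.instance Definition _ := GRing.RMorphism.copy specialize specialize.

Lemma specializeX i : specialize 'X_(lift ord0 i) = 'X_i ^+ n.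
Proof. by rewrite /specialize comp_mpolyXU -tnth_nth tnth_mktuple liftK. Qed.

Lemma specializeX0 : specialize 'X_ord0 = 0.
Proof. by rewrite /specialize comp_mpolyXU -tnth_nth tnth_mktuple unlift_none. Qed.

Lemma specialize_shift : specialize F = h \mPo [tuple 'X_i ^+ n | i < m].
Proof.
elim/mpoly_ring_ind: h => [c|i|p q IHp IHq|p q IHp IHq].
- by rewrite !comp_mpolyC /specialize comp_mpolyC.
- rewrite !comp_mpolyXU -!tnth_nth !tnth_mktuple rmorphB /=.
  by rewrite specializeX specializeX0 subr0.
- by rewrite !rmorphD /= IHp IHq.
- by rewrite !rmorphM /= IHp IHq.
Qed.

Lemma shift_in_locus : in_locus_ideal X T ord0 F.
Proof.
have evalF s w : (ren s F).@[w] = h.@[fun i => w (s (lift ord0 i)) - w (s ord0)].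
  rewrite /ren !comp_mpoly_meval; apply: meval_eq => i.
  rewrite tnth_mktuple mevalB !mevalXU !tnth_mktuple !mevalXU //.
split=> [a b c sub uabc s sab sbc|a b Ta Tb nab s sab sbc]; apply: mpoly_eq0 => w; rewrite evalF.
  have [/imsetP[i _ ai] /imsetP[j _ bj] /imsetP[l _ cl]] : [/\ a \in X, b \in X & c \in X].
    by split; apply: (subsetP sub); rewrite !inE eqxx ?orbT.
  move: uabc sab sbc; rewrite ai bj cl => uabc sab sbc.
  apply: (@component_eq0_triple _ i j l); rewrite ?sab ?sbc //.
case/imsetP: Ta => i; rewrite inE => /eqP ei ai; case/imsetP: Tb => j; rewrite inE => /eqP ej bj.
subst a b; apply: (@component_eq0_pair _ i j); rewrite ?sab ?sbc ?subrr //.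
Qed.

(** Each x_i with [i] in [A] divides the product: it comes from x_i^n when [e i] is 0, and from x^e
    otherwise. The quotient, up to the variables outside [A], is the product of the [r i]. *)
Lemma specialize_gen (A : {set 'I_m}) :
  exists r, (\prod_i 'X_i ^+ e i) * specialize (gen y 'X_ord0 X T [set lift ord0 i | i in A])
    = r * fermat_gen C n A.
Proof.
have XA : X :\: [set lift ord0 i | i in A] = [set lift ord0 i | i in ~: A].
  apply/setP => i; rewrite inE; case: (unliftP ord0 i) => [j|] ->.
    by rewrite !(mem_imset _ _ lift_inj) !inE andbT.
  have nm (B : {set 'I_m}) : (ord0 \in [set lift ord0 i | i in B]) = false.
    by apply/negP => /imsetP[j _ /eqP]; rewrite (negPf (neq_lift _ _)).
  by rewrite !nm andbF.
have AT : [set lift ord0 i | i in A] :&: T = [set lift ord0 i | i in A :&: [set i | e i == 0]].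
  by rewrite imsetI //; apply: in2W lift_inj.
have vdmE (B : {set 'I_m}) : vdm (specialize \o y) [set lift ord0 i | i in B] = vdm Y B.
  by rewrite vdm_lift; apply: eq_vdm => i /=; rewrite specializeX.
rewrite (rmorph_gen specialize) /= specializeX0 /gen XA AT !vdmE fermat_genE.
rewrite big_imset /=; last by move=> i j _ _; apply: lift_inj.
under [X in X * _ * _]eq_bigr => i _ do rewrite specializeX sub0r.
pose r i : P := if e i == 0 then - 'X_i ^+ n' else 'X_i ^+ (e i).-1.
have prodE : \prod_(i in A) 'X_i ^+ e i * \prod_(i in A :&: [set i | e i == 0]) (- 'X_i ^+ n)
    = \prod_(i in A) r i * \prod_(i in A) 'X_i :> P.
  under [X in _ * X = _]eq_bigl => i do rewrite !inE.
  rewrite [X in _ * X = _]big_mkcondr -!big_split /=; apply: eq_bigr => i _; rewrite /r.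
  case: eqP => [->|/eqP]; first by rewrite expr0 mul1r mulNr -exprSr.
  by rewrite -val_eqE /= -lt0n mulr1 => e_gt0; rewrite -exprSr prednK.
rewrite (bigID (mem A)) /=; set pA := \prod_(i in A) 'X_i ^+ e i in prodE *.
exists (\prod_(i | i \notin A) 'X_i ^+ e i * \prod_(i in A) r i).
set pT := \prod_(i in A :&: _) _ in prodE *.
set pB := \prod_(i | i \notin A) _; set pr := \prod_(i in A) r i in prodE *.
have -> : pA * pB * (pT * vdm Y A * vdm Y (~: A)) = (pA * pT) * (pB * vdm Y A * vdm Y (~: A)).
  by ring.
by rewrite prodE; ring.
Qed.

Lemma component_in_span :
  span (fun A : {set 'I_m} => #|A| == m./2) (fermat_gen C n)
    ((\prod_i 'X_i ^+ e i) * (h \mPo [tuple 'X_i ^+ n | i < m])).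
Proof.
set S := span _ _; have [S0 SD SM] : ideal S := ideal_span _ _.
rewrite -specialize_shift.
have cX : #|X| = m by rewrite card_imset ?cardsT ?card_ord //; apply: lift_inj.
(* The ideal used is the preimage of the span under specialisation followed by multiplication by
   x^e. *)
apply: (@locus_ideal_generated _ _ X T ord0 (fun q => S ((\prod_i 'X_i ^+ e i) * specialize q)));
  last exact: shift_in_locus.
- by apply/negP => /imsetP[j _ /eqP]; rewrite (negPf (neq_lift _ _)).
- by apply: imsetS; apply: subsetT.
- split=> [|p q Sp Sq|r p Sp]; first by rewrite rmorph0 mulr0.
    by rewrite rmorphD mulrDr; apply: SD.
  by rewrite rmorphM mulrCA; apply: SM.
- move=> A sAX; rewrite cX => cA; pose B := [set i | lift ord0 i \in A].
  have AE : A = [set lift ord0 i | i in B].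
    apply/setP => i; apply/idP/imsetP => [Ai|[j]]; last by rewrite inE => Aj ->.
    by have /imsetP[j _ ij] := subsetP sAX _ Ai; exists j; rewrite // inE -ij.
  have [r genB] := specialize_gen B; rewrite -AE in genB; rewrite genB.
  by apply: SM; apply: mem_span; rewrite -cA AE card_imset //; apply: lift_inj.
Qed.

End FixedComponent.

Theorem fermat_ideal_generated :
  generated_by (fun A : {set 'I_m} => #|A| == m./2) (@fermat_gen C N n) (@fermat_ideal C N n).
Proof.
move=> f; split=> [f_in|[c ->]]; last first.
  apply: ideal_sum (ideal_fermat _ _ _) _ => A _.
  by have [_ _ IM] := ideal_fermat C N n; apply/IM/fermat_gen_in_ideal.
rewrite [f](sum_component n'); apply: ideal_sum (ideal_span _ _) _ => e _.
exact: component_in_span.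
Qed.

End Generators.

Theorem proposition3p2 (R : realType) (N n : nat)
    (hN : (2 <= N)%N) (hn : (3 <= n)%N) :
  (forall M : nat, N = (2 * M)%N ->
     generated_by (fun A : {set 'I_N.+1} => #|A| == M)
       (@fermat_gen (complex R) N n) (@fermat_ideal (complex R) N n))
  /\
  (forall M : nat, N = (2 * M + 1)%N ->
     generated_by (fun A : {set 'I_N.+1} => #|A| == (M + 1)%N)
       (@fermat_gen (complex R) N n) (@fermat_ideal (complex R) N n)).
Proof.
case: n hn => // n' hn.
(* Both parities are the case where |A| is half of N + 1 rounded down. *)
have half := @fermat_ideal_generated (complex R) N n' hN hn.
split=> M NE.
  by have <- : N.+1./2 = M by move: NE; clear; lia.
by have <- : N.+1./2 = (M + 1)%N by move: NE; clear; lia.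
Qed.
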